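(* Let $A,Q\in\mathbb{R}^{n\times n}$ be nonsingular and let $\alpha>0$, $\beta>0$. If $$|1-\alpha||1-\beta|<1\quad\text{and}\quad \alpha\beta\Vert A^{-1}Q\Vert\Vert Q^{-1}\Vert<(1-|1-\alpha|)(1-|1-\beta|),$$ then for any $b\in\mathbb{R}^n$ the equation $Ax-|x|-b=0$ has a unique solution $x^*\in\mathbb{R}^n$, and the sequence $\{(x^{(k)},y^{(k)})\}_{k=0}^\infty$ generated by the MGSOR iteration converges to $(x^*,y^* )$ with $y^*=Q^{-1}|x^*|$ for any given initial vectors $x^{(0)},y^{(0)}\in\mathbb{R}^n$.
   Context: For $x\in\mathbb{R}^n$, $|x|$ is the componentwise absolute value. $\Vert\cdot\Vert$ is the matrix 2-norm. The MGSOR iteration for $Ax-|x|-b=0$ with parameters $\alpha=\alpha_{\rm MGSOR}$, $\beta=\beta_{\rm MGSOR}$, $Q=Q_{\rm MGSOR}$ is, for $k=0,1,2,\dots$, $$x^{(k+1)}=(1-\alpha)x^{(k)}+\alpha A^{-1}(Qy^{(k)}+b),\qquad y^{(k+1)}=(1-\beta)y^{(k)}+\beta Q^{-1}|x^{(k+1)}|.$$ *)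

(* Defs.v *)
From HB Require Import structures.
From mathcomp Require Import all_boot all_order all_algebra.
From mathcomp Require Import all_classical all_reals all_analysis.

Set Implicit Arguments.
Unset Strict Implicit.
Unset Printing Implicit Defensive.

Import Order.TTheory GRing.Theory Num.Theory.
Import numFieldNormedType.Exports.

Local Open Scope classical_set_scope.
Local Open Scope ring_scope.

Definition vabs (R : realType) (n : nat) (x : 'cV[R]_n) : 'cV[R]_n :=
  map_mx (fun t : R => `|t|) x.

(* The library's own norm on matrices and vectors is the max of the absolute
   values of the entries, so the Euclidean norm is defined here. *)
Definition norm2 (R : realType) (n : nat) (x : 'cV[R]_n) : R :=
  Num.sqrt (\sum_(i < n) x i 0 ^+ 2).

(* Operator norm induced by norm2. The set is bounded above (for instance by
   the Frobenius norm of M), so sup is a true supremum for n > 0; for n = 0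
   the set is empty and sup takes the value 0. *)
Definition mxnorm2 (R : realType) (m n : nat) (M : 'M[R]_(m, n)) : R :=
  sup [set norm2 (M *m x) | x in [set x : 'cV[R]_n | norm2 x = 1]].

(* One step (x_k, y_k) |-> (x_{k+1}, y_{k+1}); the update of y uses the new x. *)
Definition mgsor_step (R : realType) (n : nat) (A Q : 'M[R]_n)
    (alpha beta : R) (b : 'cV[R]_n) (z : 'cV[R]_n * 'cV[R]_n) :
    'cV[R]_n * 'cV[R]_n :=
  let x' := (1 - alpha) *: z.1 + alpha *: (invmx A *m (Q *m z.2 + b)) in
  let y' := (1 - beta) *: z.2 + beta *: (invmx Q *m vabs x') in
  (x', y').

Definition mgsor (R : realType) (n : nat) (A Q : 'M[R]_n)
    (alpha beta : R) (b x0 y0 : 'cV[R]_n) (k : nat) : 'cV[R]_n * 'cV[R]_n :=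
  iter k (mgsor_step A Q alpha beta b) (x0, y0).

(* Main.v *)
Require Import Defs.
From HB Require Import structures.
From mathcomp Require Import all_boot all_order all_algebra.
From mathcomp Require Import all_classical all_reals all_analysis.
From mathcomp Require Import ring lra.

(** Under the hypotheses both [a = |1 - alpha|] and [c = |1 - beta|] are less
than [1]: their product is, and the right-hand side of the second hypothesis
is positive, so [1 - a] and [1 - c] have the same sign and cannot both be
negative. Write [p = ||A^-1 Q||] and [q = ||Q^-1||].

Existence and uniqueness: the solutions are the fixed points of
[x |-> A^-1 (|x| + b)]. The componentwise absolute value is nonexpansive for
the Euclidean norm and [||A^-1|| <= p q], so this map is Lipschitz with constant
[p q]. From [1 - a <= alpha], [1 - c <= beta] and
[alpha beta p q < (1 - a) (1 - c)] it follows that [p q < 1], and the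
contraction principle for the Euclidean norm applies
([norm2_contraction_fixpoint]).

Convergence: [(x*, Q^-1 |x*|)] is a fixed point of the iteration, and the
Euclidean errors [e], [f] of the two components satisfy
[e' <= a e + alpha p f] and [f' <= c f + beta q e'] ([mgsor_step_error]). The
second hypothesis says precisely that some positive weights [s], [t] turn this
coupled recursion into a contraction ([coupled_contraction_weights]), so that
the errors are at most [s E theta ^ k] and [t E theta ^ k] for some
[theta < 1] ([coupled_recursion_decay]). *)

Set Implicit Arguments.
Unset Strict Implicit.
Unset Printing Implicit Defensive.

Import Order.TTheory GRing.Theory Num.Theory.
Import numFieldNormedType.Exports.

Local Open Scope classical_set_scope.
Local Open Scope ring_scope.

(** * The Euclidean norm *)

Lemma norm2_ge0 (R : realType) (n : nat) (x : 'cV[R]_n) : 0 <= norm2 x.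
Proof. exact: sqrtr_ge0. Qed.

Lemma norm2_sqr (R : realType) (n : nat) (x : 'cV[R]_n) :
  norm2 x ^+ 2 = \sum_(i < n) x i 0 ^+ 2.
Proof. by rewrite sqr_sqrtr // sumr_ge0 // => i _; rewrite sqr_ge0. Qed.

Lemma normr_entry_le_norm2 (R : realType) (n : nat) (x : 'cV[R]_n) i :
  `|x i 0| <= norm2 x.
Proof.
rewrite -sqrtr_sqr ler_wsqrtr // (bigD1 i) //= lerDl sumr_ge0 // => j _.
exact: sqr_ge0.
Qed.

Lemma norm2_eq0 (R : realType) (n : nat) (x : 'cV[R]_n) :
  norm2 x = 0 -> x = 0.
Proof.
move=> x0; apply/colP => i; rewrite mxE; apply/normr0_eq0/le_anti.
by rewrite normr_ge0 -x0 normr_entry_le_norm2.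
Qed.

Lemma norm20 (R : realType) (n : nat) : norm2 (0 : 'cV[R]_n) = 0.
Proof.
by rewrite /norm2 big1 ?sqrtr0 // => i _; rewrite mxE expr0n.
Qed.

Lemma norm2Z (R : realType) (n : nat) (k : R) (x : 'cV[R]_n) :
  norm2 (k *: x) = `|k| * norm2 x.
Proof.
rewrite -sqrtr_sqr -sqrtrM ?sqr_ge0 // mulr_sumr; congr Num.sqrt.
by apply: eq_bigr => i _; rewrite mxE exprMn.
Qed.

Lemma norm2_le_mono (R : realType) (n : nat) (x y : 'cV[R]_n) :
  (forall i, `|x i 0| <= `|y i 0|) -> norm2 x <= norm2 y.
Proof.
move=> le_xy; apply: ler_wsqrtr; apply: ler_sum => i _.
rewrite -(real_normK (num_real (x i 0))) -(real_normK (num_real (y i 0))).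
by rewrite lerXn2r ?nnegrE.
Qed.

(** The Cauchy-Schwarz inequality, from the nonnegativity of
[sum_i (|y| x_i - |x| y_i) ^ 2 = 2 |x| |y| (|x| |y| - <x, y>)]. *)
Lemma dot_le_norm2M (R : realType) (n : nat) (x y : 'cV[R]_n) :
  \sum_(i < n) x i 0 * y i 0 <= norm2 x * norm2 y.
Proof.
have [x0|x_neq0] := eqVneq (norm2 x) 0.
  rewrite x0 mul0r big1 // => i _.
  by rewrite (norm2_eq0 x0) mxE mul0r.
have [y0|y_neq0] := eqVneq (norm2 y) 0.
  rewrite y0 mulr0 big1 // => i _.
  by rewrite (norm2_eq0 y0) mxE mulr0.
have xy_gt0 : 0 < norm2 x * norm2 y.
  by rewrite mulr_gt0 // lt_neqAle norm2_ge0 andbT eq_sym.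
have : 0 <= \sum_(i < n) (norm2 y * x i 0 - norm2 x * y i 0) ^+ 2.
  by rewrite sumr_ge0 // => i _; rewrite sqr_ge0.
have sqr_expand i : (norm2 y * x i 0 - norm2 x * y i 0) ^+ 2
    = norm2 y ^+ 2 * x i 0 ^+ 2 + norm2 x ^+ 2 * y i 0 ^+ 2
      - 2 * (norm2 x * norm2 y) * (x i 0 * y i 0) by ring.
under eq_bigr => i _ do rewrite sqr_expand.
rewrite sumrB big_split /= -!mulr_sumr -!norm2_sqr => le0.
rewrite -(ler_pM2l xy_gt0); nra.
Qed.

Lemma ler_norm2D (R : realType) (n : nat) (x y : 'cV[R]_n) :
  norm2 (x + y) <= norm2 x + norm2 y.
Proof.
have xy_ge0 : 0 <= norm2 x + norm2 y by rewrite addr_ge0 ?norm2_ge0.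
rewrite -(ler_pXn2r (n := 2)) ?nnegrE ?norm2_ge0 // norm2_sqr.
under eq_bigr => i _ do rewrite mxE sqrrD.
rewrite 2!big_split /= -!norm2_sqr sumrMnl sqrrD lerD2r lerD2l.
by rewrite lerMn2r dot_le_norm2M.
Qed.

Lemma norm2_vabsB (R : realType) (n : nat) (x y : 'cV[R]_n) :
  norm2 (vabs x - vabs y) <= norm2 (x - y).
Proof.
by apply: norm2_le_mono => i; rewrite !mxE; exact: ler_dist_dist.
Qed.

Lemma norm2_le_entries (R : realType) (n : nat) (x : 'cV[R]_n) (d : R) :
  (forall i, `|x i 0| <= d) -> norm2 x <= n%:R * d.
Proof.
move=> le_xd; case: n x le_xd => [|n] x le_xd.
  by rewrite /norm2 big_ord0 sqrtr0 mul0r.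
have d_ge0 : 0 <= d := le_trans (normr_ge0 _) (le_xd 0).
have nd_ge0 : 0 <= n.+1%:R * d by rewrite mulr_ge0.
rewrite -(ler_pXn2r (n := 2)) ?nnegrE ?norm2_ge0 // norm2_sqr.
have le_nd : \sum_(i < n.+1) x i 0 ^+ 2 <= \sum_(i < n.+1) d ^+ 2.
  apply: ler_sum => i _; rewrite -(real_normK (num_real _)).
  by rewrite lerXn2r ?nnegrE.
apply: (le_trans le_nd); rewrite sumr_const card_ord -[leLHS]mulr_natl exprMn.
by rewrite ler_wpM2r ?sqr_ge0 // -natrX ler_nat -mulnn leq_pmulr.
Qed.

Lemma mx_norm_le_norm2 (R : realType) (n : nat) (x : 'cV[R]_n) :
  `|x| <= norm2 x.
Proof.
rewrite [leLHS]/Num.norm /= mx_normrE; apply: bigmax_le; first exact: norm2_ge0.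
by move=> [i j] _ /=; rewrite ord1 normr_entry_le_norm2.
Qed.

Lemma norm2_le_mx_norm (R : realType) (n : nat) (x : 'cV[R]_n) :
  norm2 x <= n%:R * `|x|.
Proof.
apply: norm2_le_entries => i; rewrite [leRHS]/Num.norm /= mx_normrE.
exact: (le_bigmax _ (fun ij => `|x ij.1 ij.2|) (i, 0)).
Qed.

(** * The induced operator norm *)

Lemma mxnorm2_has_ubound (R : realType) (m n : nat) (M : 'M[R]_(m, n)) :
  has_ubound [set norm2 (M *m x) | x in [set x : 'cV[R]_n | norm2 x = 1]].
Proof.
exists (m%:R * \sum_(i < m) \sum_(j < n) `|M i j|) => _ [x /= x1 <-].
apply: norm2_le_entries => i; rewrite mxE.
apply: (le_trans (ler_norm_sum _ _ _)).
apply: (@le_trans _ _ (\sum_(j < n) `|M i j|)).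
  apply: ler_sum => j _; rewrite normrM ler_piMr //.
  by rewrite -x1 normr_entry_le_norm2.
by rewrite [leRHS](bigD1 i) //= lerDl sumr_ge0 // => k _; rewrite sumr_ge0.
Qed.

Lemma norm2_mulmx_le (R : realType) (m n : nat) (M : 'M[R]_(m, n))
    (x : 'cV[R]_n) :
  norm2 (M *m x) <= mxnorm2 M * norm2 x.
Proof.
have [x0|x_neq0] := eqVneq (norm2 x) 0.
  by rewrite x0 mulr0 (norm2_eq0 x0) mulmx0 norm20.
have x_gt0 : 0 < norm2 x by rewrite lt_neqAle eq_sym x_neq0 norm2_ge0.
rewrite -ler_pdivrMr //; apply: ub_le_sup; first exact: mxnorm2_has_ubound.
exists ((norm2 x)^-1 *: x) => /=.
  by rewrite norm2Z ger0_norm ?invr_ge0 ?norm2_ge0 // mulVf.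
by rewrite -scalemxAr norm2Z ger0_norm ?invr_ge0 ?norm2_ge0 // mulrC.
Qed.

(** The defining set is empty when [n = 0]; the supremum is then [0]. *)
Lemma mxnorm2_ge0 (R : realType) (m n : nat) (M : 'M[R]_(m, n)) :
  0 <= mxnorm2 M.
Proof.
rewrite /mxnorm2; have [->|/set0P[y [x x1 xy]]] := eqVneq
    [set norm2 (M *m x) | x in [set x : 'cV[R]_n | norm2 x = 1]] set0.
  by rewrite sup0.
apply: (@le_trans _ _ y); first by rewrite -xy norm2_ge0.
by apply: ub_le_sup; [exact: mxnorm2_has_ubound | exists x].
Qed.

(** * Convergence and fixed points in the Euclidean norm *)

(** The topology on vectors is that of the maximum norm. *)
Lemma norm2_squeeze_cvg (R : realType) (n : nat) (u : nat -> 'cV[R]_n)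
    (l : 'cV[R]_n) (d : nat -> R) :
  (forall k, norm2 (u k - l) <= d k) -> d @ \oo --> 0 -> u @ \oo --> l.
Proof.
move=> le_d d_cvg; apply/subr_cvg0/norm_cvg0P.
apply: (squeeze_cvgr _ (cvg_cst 0) d_cvg).
by apply: nearW => k; rewrite normr_ge0 (le_trans (mx_norm_le_norm2 _)).
Qed.

(** Makes matrix spaces complete as normed spaces, so that absolutely
convergent series of vectors converge. *)
HB.instance Definition _ (R : realType) (m n : nat) :=
  Uniform_isComplete.Build 'M[R]_(m, n) (@mx_complete R m n).

(** A contraction for the Euclidean norm need not contract the norm that
defines the topology, so the contraction principle is applied to the Euclidean
norm by hand: the increments of the iterates are dominated by a geometric
series. *)
Lemma norm2_contraction_fixpoint (R : realType) (n : nat)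
    (F : 'cV[R]_n -> 'cV[R]_n) (q : R) :
  0 <= q < 1 -> (forall x y, norm2 (F x - F y) <= q * norm2 (x - y)) ->
  exists xs, F xs = xs /\ forall x, F x = x -> x = xs.
Proof.
move=> /andP[q_ge0 q_lt1] F_contr.
have norm_q : `|q| < 1 by rewrite ger0_norm.
pose u k := iter k F 0; pose C := norm2 (u 1%N - u 0%N).
have u_incr k : norm2 (u k.+1 - u k) <= C * q ^+ k.
  elim: k => [|k IHk]; first by rewrite mulr1.
  apply: (le_trans (F_contr _ _)); rewrite exprS mulrCA.
  exact: ler_wpM2l.
have telu_cvg : cvgn (series (telescope u)).
  apply: normed_cvg; apply: (@series_le_cvg _ _ (geometric C q)).
  - by move=> k; exact: normr_ge0.
  - by move=> k; rewrite mulr_ge0 ?norm2_ge0 ?exprn_ge0.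
  - by move=> k; exact: (le_trans (mx_norm_le_norm2 _) (u_incr k)).
  - exact: is_cvg_geometric_series.
have [xs u_cvg] : exists xs : 'cV[R]_n, u @ \oo --> xs.
  exists (limn (series (telescope u)) + u 0%N).
  have uE : (fun k => series (telescope u) k + u 0%N) = u.
    by apply/funext => k; rewrite [RHS]eq_sum_telescope addrC.
  by rewrite -[X in X @ _]uE; apply: cvgD; [exact: telu_cvg | exact: cvg_cst].
have Fxs : F xs = xs.
  have uS_cvg : (fun k => u k.+1) @ \oo --> F xs.
    apply: (@norm2_squeeze_cvg _ _ _ _ (fun k => q * (n%:R * `|u k - xs|))).
      move=> k; apply: (le_trans (F_contr _ _)).
      by rewrite ler_wpM2l // norm2_le_mx_norm.
    rewrite -(mulr0 q); apply: cvgMl_tmp; rewrite -(mulr0 n%:R); apply: cvgMl_tmp.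
    by apply/norm_cvg0P/subr_cvg0.
  apply: (cvg_unique _ uS_cvg); first exact: norm_hausdorff.
  by have := u_cvg; rewrite -(cvg_shiftS u).
exists xs; split=> // x Fx; apply/subr0_eq/norm2_eq0/eqP.
have le_q := F_contr x xs; rewrite Fx Fxs in le_q.
by have := norm2_ge0 (x - xs); nra.
Qed.

(** * Coupled linear recursions *)

(** A rate below [1] exists as soon as [p t < (1 - a) s] and
[q s < (1 - c) t]. With [t = 1 - a] these conditions become [p < s] and
[q s < (1 - a) (1 - c)]; as [p q < (1 - a) (1 - c)], both hold once [s] exceeds
[p] by little enough. *)
Lemma coupled_contraction_weights (R : realType) (a c p q : R) :
  0 <= a < 1 -> 0 <= c < 1 -> 0 <= p -> 0 <= q ->
  p * q < (1 - a) * (1 - c) ->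
  exists s t theta : R, [/\ 0 < s, 0 < t, 0 <= theta < 1,
    a * s + p * t <= theta * s & c * t + q * s <= theta * t].
Proof.
move=> /andP[a_ge0 a_lt1] /andP[c_ge0 c_lt1] p_ge0 q_ge0 pq_lt.
pose gap := (1 - a) * (1 - c) - p * q.
have gap_gt0 : 0 < gap by rewrite subr_gt0.
have q1_gt0 : 0 < q + 1 by lra.
pose delta := gap / (q + 1).
have delta_gt0 : 0 < delta by rewrite divr_gt0.
have delta_q : delta * (q + 1) = gap by rewrite divfK // gt_eqF.
pose s := p + delta; pose t := 1 - a.
have s_gt0 : 0 < s by rewrite ltr_wpDl.
have t_gt0 : 0 < t by rewrite subr_gt0.
pose r1 := (a * s + p * t) / s; pose r2 := (c * t + q * s) / t.
have r1_lt1 : r1 < 1 by rewrite ltr_pdivrMr // /s /t; nra.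
have r2_lt1 : r2 < 1 by rewrite ltr_pdivrMr // /s /t /gap in delta_q *; nra.
have r1_ge0 : 0 <= r1.
  by apply: divr_ge0 (ltW s_gt0); rewrite addr_ge0 ?mulr_ge0 ?(ltW s_gt0)
    ?(ltW t_gt0).
exists s, t, (Num.max r1 r2); split => //.
- by rewrite le_max r1_ge0 gt_max r1_lt1 r2_lt1.
- by rewrite -ler_pdivrMr // le_max lexx.
- by rewrite -ler_pdivrMr // le_max lexx orbT.
Qed.

(** The weights bound a step whose second component uses the old value [e k];
here it uses [e k.+1], whose bound is smaller because the rate is below [1]. *)
Lemma coupled_recursion_decay (R : realType) (a c p q : R) (e f : nat -> R) :
  0 <= a < 1 -> 0 <= c < 1 -> 0 <= p -> 0 <= q ->
  p * q < (1 - a) * (1 - c) ->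
  (forall k, 0 <= e k) -> (forall k, 0 <= f k) ->
  (forall k, e k.+1 <= a * e k + p * f k) ->
  (forall k, f k.+1 <= c * f k + q * e k.+1) ->
  exists C D theta : R, 0 <= theta < 1 /\
    forall k, e k <= C * theta ^+ k /\ f k <= D * theta ^+ k.
Proof.
move=> a01 c01 p_ge0 q_ge0 pq_lt e_ge0 f_ge0 e_rec f_rec.
have [s [t [theta [s_gt0 t_gt0 theta01 s_le t_le]]]] :=
  coupled_contraction_weights a01 c01 p_ge0 q_ge0 pq_lt.
have /andP[a_ge0 _] := a01; have /andP[c_ge0 _] := c01.
have /andP[theta_ge0 theta_lt1] := theta01.
(* chosen so that s * E and t * E dominate e 0 and f 0 *)
pose E := e 0%N / s + f 0%N / t.
have E_ge0 : 0 <= E by rewrite addr_ge0 // divr_ge0 // ltW.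
exists (s * E), (t * E), theta; split=> // k.
elim: k => [|k [IHe IHf]].
  rewrite !mulr1 !mulrDr (mulrC s (_ / s)) (mulrC t (_ / t)) !divfK ?gt_eqF //.
  by rewrite lerDl lerDr !mulr_ge0 ?invr_ge0 ?(ltW s_gt0) ?(ltW t_gt0).
pose w := E * theta ^+ k.
have w_ge0 : 0 <= w by rewrite mulr_ge0 ?exprn_ge0.
rewrite -!mulrA -/w in IHe IHf.
have step (z : R) : z * E * theta ^+ k.+1 = theta * z * w.
  by rewrite /w exprS; ring.
rewrite !step.
have le_e : e k.+1 <= theta * s * w.
  apply: (le_trans (e_rec k)); apply: le_trans (ler_wpM2r w_ge0 s_le).
  by rewrite mulrDl -!mulrA lerD // ler_wpM2l.
split=> //.
apply: (le_trans (f_rec k)); apply: le_trans (ler_wpM2r w_ge0 t_le).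
rewrite mulrDl -!mulrA lerD // ler_wpM2l //.
apply: (le_trans le_e); rewrite ler_wpM2r //.
by rewrite ler_piMl // ltW.
Qed.

(** * The iteration *)

Lemma norm2_relax (R : realType) (n : nat) (g h : R)
    (x x' u u' : 'cV[R]_n) :
  norm2 ((g *: x + h *: u) - (g *: x' + h *: u'))
    <= `|g| * norm2 (x - x') + `|h| * norm2 (u - u').
Proof.
rewrite opprD addrACA -!scalerBr -!norm2Z; exact: ler_norm2D.
Qed.

(** The second bound involves the error of the updated first component, since
that is the one whose absolute value enters the step for [y]. *)
Lemma mgsor_step_error (R : realType) (n : nat) (A Q : 'M[R]_n)
    (alpha beta : R) (b : 'cV[R]_n) (z w : 'cV[R]_n * 'cV[R]_n) :
  0 <= alpha -> 0 <= beta ->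
  let z' := mgsor_step A Q alpha beta b z in
  let w' := mgsor_step A Q alpha beta b w in
  norm2 (z'.1 - w'.1) <= `|1 - alpha| * norm2 (z.1 - w.1)
    + alpha * mxnorm2 (invmx A *m Q) * norm2 (z.2 - w.2) /\
  norm2 (z'.2 - w'.2) <= `|1 - beta| * norm2 (z.2 - w.2)
    + beta * mxnorm2 (invmx Q) * norm2 (z'.1 - w'.1).
Proof.
move=> alpha_ge0 beta_ge0 z' w'; split.
  apply: (le_trans (norm2_relax _ _ _ _ _ _)); rewrite lerD2l ger0_norm //.
  rewrite -mulrA ler_wpM2l // -mulmxBr opprD addrACA subrr addr0 -mulmxBr.
  by rewrite mulmxA norm2_mulmx_le.
apply: (le_trans (norm2_relax _ _ _ _ _ _)); rewrite lerD2l ger0_norm //.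
rewrite -mulrA ler_wpM2l // -mulmxBr.
apply: (le_trans (norm2_mulmx_le _ _)).
by rewrite ler_wpM2l ?mxnorm2_ge0 // norm2_vabsB.
Qed.

Lemma mgsor_step_fixed (R : realType) (n : nat) (A Q : 'M[R]_n)
    (alpha beta : R) (b xs : 'cV[R]_n) :
  Q \in unitmx -> invmx A *m (vabs xs + b) = xs ->
  mgsor_step A Q alpha beta b (xs, invmx Q *m vabs xs)
    = (xs, invmx Q *m vabs xs).
Proof.
move=> Q_unit xs_fix; rewrite /mgsor_step /= (mulKVmx Q_unit) xs_fix.
have relax_id (g : R) (v : 'cV[R]_n) : (1 - g) *: v + g *: v = v.
  by rewrite -scalerDl subrK scale1r.
by rewrite !relax_id.
Qed.

Lemma ave_fixed_pointP (R : realType) (n : nat) (A : 'M[R]_n)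
    (b x : 'cV[R]_n) :
  A \in unitmx ->
  A *m x - vabs x - b = 0 <-> invmx A *m (vabs x + b) = x.
Proof.
move=> A_unit; rewrite -addrA -opprD; split=> [/subr0_eq <-|xs_fix].
  exact: mulKmx.
by apply/eqP; rewrite subr_eq0 -{1}xs_fix mulKVmx.
Qed.

Theorem corollary7 (R : realType) (n : nat) (A Q : 'M[R]_n) (alpha beta : R)
    (A_unit : A \in unitmx) (Q_unit : Q \in unitmx)
    (alpha_gt0 : 0 < alpha) (beta_gt0 : 0 < beta)
    (h1 : `|1 - alpha| * `|1 - beta| < 1)
    (h2 : alpha * beta * mxnorm2 (invmx A *m Q) * mxnorm2 (invmx Q)
          < (1 - `|1 - alpha|) * (1 - `|1 - beta|)) :
  forall b : 'cV[R]_n,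
    exists xs : 'cV[R]_n,
      [/\ A *m xs - vabs xs - b = 0,
          (forall x : 'cV[R]_n, A *m x - vabs x - b = 0 -> x = xs) &
          (forall x0 y0 : 'cV[R]_n,
             mgsor A Q alpha beta b x0 y0 @ \oo
               --> ((xs, invmx Q *m vabs xs) : 'cV[R]_n * 'cV[R]_n))].
Proof.
move=> b.
set a := `|1 - alpha| in h1 h2; set c := `|1 - beta| in h1 h2.
set p := mxnorm2 (invmx A *m Q) in h2; set q := mxnorm2 (invmx Q) in h2.
have p_ge0 : 0 <= p := mxnorm2_ge0 _.
have q_ge0 : 0 <= q := mxnorm2_ge0 _.
have [a_ge0 c_ge0] : 0 <= a /\ 0 <= c by split; exact: normr_ge0.
have ac_gt0 : 0 < (1 - a) * (1 - c).
  by apply: le_lt_trans h2; rewrite !mulr_ge0 // ltW.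
have a_lt1 : a < 1.
  by rewrite ltNge; apply/negP => a_ge1; nra.
have c_lt1 : c < 1 by nra.
have a_alpha : 1 - a <= alpha by have := ler_norm (1 - alpha); rewrite -/a; lra.
have c_beta : 1 - c <= beta by have := ler_norm (1 - beta); rewrite -/c; lra.
have pq_lt1 : p * q < 1.
  rewrite -(ltr_pM2l (mulr_gt0 alpha_gt0 beta_gt0)) mulr1 mulrA.
  apply: (lt_le_trans h2); apply: ler_pM => //; lra.
have F_contr x y : norm2 (invmx A *m (vabs x + b) - invmx A *m (vabs y + b))
    <= p * q * norm2 (x - y).
  rewrite -mulmxBr opprD addrACA subrr addr0.
  (* A^-1 v = (A^-1 Q) (Q^-1 v) *)
  rewrite -{1}(mulKVmx Q_unit (vabs x - vabs y)) (mulmxA (invmx A)).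
  apply: (le_trans (norm2_mulmx_le _ _)); rewrite -mulrA -/p ler_wpM2l //.
  apply: (le_trans (norm2_mulmx_le _ _)); rewrite -/q ler_wpM2l //.
  exact: norm2_vabsB.
have pq01 : 0 <= p * q < 1 by rewrite mulr_ge0.
have [xs [xs_fix xs_uniq]] := norm2_contraction_fixpoint pq01 F_contr.
exists xs; split.
- exact/ave_fixed_pointP.
- by move=> x /(ave_fixed_pointP _ _ A_unit); exact: xs_uniq.
move=> x0 y0.
set z := mgsor A Q alpha beta b x0 y0; set ys := invmx Q *m vabs xs.
have z_err k := mgsor_step_error A Q b (z k) (xs, ys) (ltW alpha_gt0)
  (ltW beta_gt0).
rewrite mgsor_step_fixed //= in z_err.
have [C [D [theta [/andP[theta_ge0 theta_lt1] decay]]]] :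
    exists C D theta : R, 0 <= theta < 1 /\ forall k : nat,
    norm2 ((z k).1 - xs) <= C * theta ^+ k /\
    norm2 ((z k).2 - ys) <= D * theta ^+ k.
  apply: (@coupled_recursion_decay _ a c (alpha * p) (beta * q)).
  - by rewrite a_ge0.
  - by rewrite c_ge0.
  - by rewrite mulr_ge0 // ltW.
  - by rewrite mulr_ge0 // ltW.
  - by apply: le_lt_trans h2; rewrite mulrACA mulrA.
  - by move=> k; exact: norm2_ge0.
  - by move=> k; exact: norm2_ge0.
  - by move=> k; have [] := z_err k.
  - by move=> k; have [] := z_err k.
have norm_theta : `|theta| < 1 by rewrite ger0_norm.
rewrite (_ : z = fun k => ((z k).1, (z k).2)); last first.
  by apply/funext => k; case: (z k).
apply: (@cvg_pair _ _ _ _ (nbhs xs) (nbhs ys)).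
  apply: (norm2_squeeze_cvg (d := geometric C theta)) => [k|].
    exact: (decay k).1.
  exact: cvg_geometric.
apply: (norm2_squeeze_cvg (d := geometric D theta)) => [k|].
  exact: (decay k).2.
exact: cvg_geometric.
Qed.
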